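(* Let $(\boldsymbol{\rho},\lambda')$ be a rigid origami with $N_v$ inner vertices, $N_h$ holes and $N_c$ inner creases. The following statements are equivalent: (1) $(\boldsymbol{\rho},\lambda')$ is first-order rigid. (2) $(\boldsymbol{\rho},\lambda')$ is statically rigid. (3) The dimension of the linear space of self-stresses at $(\boldsymbol{\rho},\lambda')$ is $3N_v+6N_h-N_c$.
   Context: Rigid origami. A rigid origami consists of rigid planar polygonal panels hinged along $N_c$ inner creases, with $N_v$ inner vertices and $N_h$ holes (a hole is represented by a closed cycle of panels and inner creases around its boundary; $N_h$ is the first Betti number). Its state is given by the folding angles $\boldsymbol{\rho}=(\rho_1,\dots,\rho_{N_c})\in(-\pi,\pi)^{N_c}$, one for each inner crease; all lengths and angles within panels (e.g. the sector angles $\alpha\in(0,2\pi)$ between adjacent creases of a panel) are fixed. $\lambda'$ is an order function recording the stacking of panels; it plays no role in the algebraic definitions below. Consistency constraint. Let $R_z(\theta),R_x(\theta)$ be the $3\times3$ rotation matrices by angle $\theta$ about the $z$- and $x$-axis. Around an inner vertex with incident creases cyclically numbered $1,\dots,n$, the constraint is $R(\boldsymbol{\rho})=\prod_{j=1}^n R_z(\alpha_j)R_x(\rho_j)=I$ (factors ordered left to right), with $\alpha_j$ the sector angle between creases $j-1$ and $j$ (indices cyclic). Around a hole with incident creases $1,\dots,n$ it is $T(\boldsymbol{\rho})=\prod_{j=1}^n \begin{pmatrix}R_z(\beta_j)&v_j\\0&1\end{pmatrix}\begin{pmatrix}R_x(\rho_j)&0\\0&1\end{pmatrix}=I$, where $\beta_j$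 and $v_j=(l_j\cos\gamma_j,l_j\sin\gamma_j,0)^T$ are fixed geometric constants (relative rotation and translation of the consecutive panel frames). The state $\boldsymbol{\rho}$ satisfies all these constraints. Independent components. Express $R$ and $T$ in one global coordinate system: conjugate $R$ by the orthogonal matrix, respectively $T$ by the rigid motion, given by the frame of panel $n$ at the given state (kept constant). Put $(A_1,A_2,A_3)=(R_{32},R_{13},R_{21})$ for each vertex; for each hole put $(A_1,A_2,A_3)=(T_{32},T_{13},T_{21})$ and $(A_4,A_5,A_6)=(T_{14},T_{24},T_{34})$. Collecting all of them gives $\boldsymbol{A}(\boldsymbol{\rho})\in\mathbb{R}^{3N_v+6N_h}$. The rigidity matrix $\mathrm{d}\boldsymbol{A}/\mathrm{d}\boldsymbol{\rho}$, of size $(3N_v+6N_h)\times N_c$, is evaluated at the given state. Explicitly, in the three rows of a vertex the column of an incident crease $j$ is $\boldsymbol{x}_j$, the unit direction vector of the crease pointing away from the vertex; in the six rows of a hole the column of an incident crease $j$ is $(\boldsymbol{x}_j;\ \boldsymbol{O}_j\times\boldsymbol{x}_j)$, with $\boldsymbol{x}_j$ the unit direction pointing away from the hole and $\boldsymbol{O}_j$ the position of the vertex on the hole boundary incident to crease $j$; columns of non-incident creases are zero. Definitions. - First-order rigid: the only solution $\boldsymbol{\rho}'\in\mathbb{R}^{N_c}$ of $(\mathrm{d}\boldsymbol{A}/\mathrm{d}\boldsymbol{\rho})\,\boldsymbol{\rho}'=\boldsymbol{0}$ is $\boldsymbol{0}$. - A load is a row vector $\boldsymbol{l}\in\mathbb{R}^{N_c}$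 (a pair of opposite torques at each inner crease). An internal force is a row vector $\boldsymbol{\omega}\in\mathbb{R}^{3N_v+6N_h}$. The rigid origami can resolve $\boldsymbol{l}$ if there is an internal force $\boldsymbol{\omega}$ with $\boldsymbol{\omega}\,(\mathrm{d}\boldsymbol{A}/\mathrm{d}\boldsymbol{\rho})=\boldsymbol{l}$. - Statically rigid: it can resolve every load. - Self-stress: a row vector $\boldsymbol{\omega}_s\in\mathbb{R}^{3N_v+6N_h}$ with $\boldsymbol{\omega}_s\,(\mathrm{d}\boldsymbol{A}/\mathrm{d}\boldsymbol{\rho})=\boldsymbol{0}$. *)

(* Defs.v *)
(* MathComp + MathComp-Analysis *)
From HB Require Import structures.
From mathcomp Require Import all_boot all_order all_algebra all_fingroup.
From mathcomp Require Import all_classical all_reals all_analysis.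

Set Implicit Arguments.
Unset Strict Implicit.
Unset Printing Implicit Defensive.

Import Order.TTheory GRing.Theory Num.Theory.
Import numFieldNormedType.Exports.
Local Open Scope ring_scope.

Section Rotations.
Variable R : realType.

Definition mx3 (s : seq (seq R)) : 'M[R]_3 := \matrix_(i, j) nth 0 (nth [::] s i) j.

Definition Rx (t : R) : 'M[R]_3 :=
  mx3 [:: [:: 1; 0;     0];
          [:: 0; cos t; - sin t];
          [:: 0; sin t; cos t]].

Definition Rz (t : R) : 'M[R]_3 :=
  mx3 [:: [:: cos t; - sin t; 0];
          [:: sin t; cos t;   0];
          [:: 0;     0;       1]].

Definition planar (l t : R) : 'cV[R]_3 := \col_i nth 0 [:: l * cos t; l * sin t; 0] i.

Definition rigid (A : 'M[R]_3) (v : 'cV[R]_3) : 'M[R]_(3 + 1) := block_mx A v 0 1%:M.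

(* (M_32, M_13, M_21) in 1-based indices *)
Definition skew_part (M : 'M[R]_3) : 'rV[R]_3 :=
  let e (k : nat) : 'I_3 := inord k in
  \row_k nth 0 [:: M (e 2) (e 1); M (e 0) (e 2); M (e 1) (e 0)] k.

End Rotations.

(* The panels, each a simple polygon drawn in the plane z = 0 of its own frame.
   The sides of all panels form one finite type; [next] goes to the following
   side, counterclockwise, of the same panel.  Side [s] runs from [start s] in
   the direction [heading s] over the length [len s]. *)
Record panels (R : realType) := Panels {
  np : nat;
  side : finType;
  next : {perm side};
  panel : side -> 'I_np;
  start : side -> 'cV[R]_3;
  heading : side -> R;
  len : side -> R;
  panel_nonempty : forall p, exists s, panel s = p;
  panel_orbit : forall s t, panel s = panel t <-> t \in porbit next s;
  start_planar : forall s, start s (inord 2) 0 = 0;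
  len_gt0 : forall s, 0 < len s;
  start_next : forall s, start (next s) = start s + planar (len s) (heading s);
  panel_simple : forall s t (a b : R),
    panel s = panel t -> s != t -> 0 <= a <= 1 -> 0 <= b <= 1 ->
    start s + a *: planar (len s) (heading s) =
      start t + b *: planar (len t) (heading t) ->
    [/\ t = next s, a = 1 & b = 0] \/ [/\ s = next t, a = 0 & b = 1];
  panel_ccw : forall p : 'I_np,
    0 < \sum_(s | panel s == p)
          (start s (inord 0) 0 * start (next s) (inord 1) 0
           - start (next s) (inord 0) 0 * start s (inord 1) 0)
}.

(* A crossing (c, b) is a passage over the inner crease c in one of its two
   senses: it leaves a panel through the side [leave] and enters another one
   through [enter], the two sides glued along c.  The crease is then directed
   as the counterclockwise side [enter], i.e. it has the panel entered on its
   left. *)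
Section Crossings.
Variables (R : realType) (P : panels R) (nc : nat).
Variable hinge : 'I_nc * bool -> side P.

Definition enter (x : 'I_nc * bool) : side P := hinge x.
Definition leave (x : 'I_nc * bool) : side P := hinge (x.1, ~~ x.2).

(* Closed cycles of panels and creases; crossing [w j] leaves the panel that
   [w (j - 1)] has entered, indices being cyclic.  Seen as a turn around a hole,
   the hole lies on the left: the directed creases point away from it and their
   tails are on its boundary. *)
Definition panel_cycle m (w : 'I_m.+1 -> 'I_nc * bool) : Prop :=
  forall j, panel (leave (w j)) = panel (enter (w (ord_pred j))).

(* Complete turns, counterclockwise, around an inner vertex: in each panel the
   side leading to the vertex is immediately followed by the one issued from
   it. *)
Definition vertex_cycle m (w : 'I_m.+1 -> 'I_nc * bool) : Prop :=
  injective w /\ forall j, next P (leave (w j)) = enter (w (ord_pred j)).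

(* Chain complex dual to the pattern: panels in degree 0, inner creases in
   degree 1, inner vertices in degree 2.  The rows of [crease_boundary] are the
   boundaries of the creases, [chain w] is the class of a closed cycle. *)
Definition crease_boundary : 'M[rat]_(nc, np P) :=
  \matrix_(c, p) ((panel (enter (c, true)) == p)%:R
                  - (panel (leave (c, true)) == p)%:R).

Definition chain m (w : 'I_m.+1 -> 'I_nc * bool) : 'rV[rat]_nc :=
  \row_c \sum_(j | (w j).1 == c) (if (w j).2 then 1 else - 1).

End Crossings.

(* The fixed data of a rigid origami.  Around the inner vertex v the incident
   creases are numbered 0, ..., vlast v, and around the hole h they are
   numbered 0, ..., hlast h. *)
Record crease_pattern (R : realType) := CreasePattern {
  paper :> panels R;
  nc : nat;
  hinge : 'I_nc * bool -> side paper;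
  hinge_inj : injective hinge;
  hinge_len : forall x, len (leave hinge x) = len (enter hinge x);

  nv : nat;
  vlast : 'I_nv -> nat;
  vcross : forall v, 'I_(vlast v).+1 -> 'I_nc * bool;
  vcrossP : forall v, vertex_cycle hinge (@vcross v);
  (* every inner vertex is listed exactly once *)
  vcross_all : forall m (w : 'I_m.+1 -> 'I_nc * bool),
    vertex_cycle hinge w -> exists! v, exists j, @vcross v j = w ord0;
  (* sector angle between the creases j - 1 and j *)
  alpha : forall v, 'I_(vlast v).+1 -> R;
  alpha_itv : forall v j, 0 < @alpha v j < 2 * pi;
  alphaP : forall v j,
    Rz (heading (enter hinge (@vcross v (ord_pred j))) + @alpha v j) =
    Rz (heading (leave hinge (@vcross v j)) + pi);

  nh : nat;
  hlast : 'I_nh -> nat;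
  hcross : forall h, 'I_(hlast h).+1 -> 'I_nc * bool;
  hcrossP : forall h, panel_cycle hinge (@hcross h);
  (* nh is the first Betti number, and the hole cycles represent a basis of the
     first homology *)
  hole_betti : nh = (\rank (kermx (crease_boundary hinge))
                     - \rank (\matrix_v chain (@vcross v)))%N;
  hole_span : (col_mx (\matrix_v chain (@vcross v)) (\matrix_h chain (@hcross h))
               == kermx (crease_boundary hinge))%MS;
  (* motion, within a panel, from the frame of the crease j - 1 to the frame of
     the crease j: origin at the tail of the crease, x-axis along it *)
  beta : forall h, 'I_(hlast h).+1 -> R;
  gamma : forall h, 'I_(hlast h).+1 -> R;
  ell : forall h, 'I_(hlast h).+1 -> R;
  ell_ge0 : forall h j, 0 <= @ell h j;
  betaP : forall h j,
    Rz (heading (enter hinge (@hcross h (ord_pred j))) + @beta h j) =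
    Rz (heading (leave hinge (@hcross h j)) + pi);
  ellP : forall h j,
    start (next paper (leave hinge (@hcross h j)))
      - start (enter hinge (@hcross h (ord_pred j))) =
    Rz (heading (enter hinge (@hcross h (ord_pred j))))
      *m planar (@ell h j) (@gamma h j)
}.

Arguments hinge {R} c x.
Arguments vcross {R} c v j.
Arguments alpha {R} c v j.
Arguments hcross {R} c h j.
Arguments beta {R} c h j.
Arguments gamma {R} c h j.
Arguments ell {R} c h j.

Section Constraints.
Variables (R : realType) (C : crease_pattern R).
Implicit Type r : 'rV[R]_(nc C).

Definition vertex_rotation (v : 'I_(nv C)) r : 'M[R]_3 :=
  \prod_(j < (vlast v).+1) (Rz (alpha C v j) * Rx (r 0 (vcross C v j).1)).

Definition hole_motion (h : 'I_(nh C)) r : 'M[R]_(3 + 1) :=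
  \prod_(j < (hlast h).+1)
    (rigid (Rz (beta C h j)) (planar (ell C h j) (gamma C h j))
     * rigid (Rx (r 0 (hcross C h j).1)) 0).

End Constraints.

(* A rigid origami (rho, lambda'): a pattern together with a state.
   [placed_rot p] and [placed_pos p] place panel p in space.  The order function
   [stacking] (lambda') is carried along but unconstrained. *)
Record rigid_origami (R : realType) := RigidOrigami {
  pattern :> crease_pattern R;
  rho : 'rV[R]_(nc pattern);
  stacking : 'I_(np pattern) -> 'I_(np pattern) -> int;
  rho_itv : forall c, - pi < rho 0 c < pi;
  placed_rot : 'I_(np pattern) -> 'M[R]_3;
  placed_pos : 'I_(np pattern) -> 'cV[R]_3;
  rot_orth : forall p, placed_rot p *m (placed_rot p)^T = 1%:M;
  rot_det : forall p, \det (placed_rot p) = 1;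
  (* the panel entered is obtained from the panel left by a rotation of angle
     rho about the directed crease *)
  hinge_rot : forall x,
    placed_rot (panel (enter (hinge pattern) x)) *m Rz (heading (enter (hinge pattern) x)) =
    placed_rot (panel (leave (hinge pattern) x))
      *m Rz (heading (leave (hinge pattern) x) + pi) *m Rx (rho 0 x.1);
  hinge_pos : forall x,
    placed_rot (panel (enter (hinge pattern) x)) *m start (enter (hinge pattern) x)
      + placed_pos (panel (enter (hinge pattern) x)) =
    placed_rot (panel (leave (hinge pattern) x))
      *m start (next pattern (leave (hinge pattern) x))
      + placed_pos (panel (leave (hinge pattern) x));
  vertex_closed : forall v : 'I_(nv pattern), vertex_rotation v rho = 1%:M;
  hole_closed : forall h : 'I_(nh pattern), hole_motion h rho = 1%:M
}.

Arguments placed_rot {R} r p.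
Arguments placed_pos {R} r p.

Section Rigidity.
Variables (R : realType) (O : rigid_origami R).

(* Global frame, at the given state, of the panel entered by the crossing x:
   x-axis along the directed crease, z-axis normal to the panel, origin at the
   tail of the crease. *)
Definition frame_rot (x : 'I_(nc O) * bool) : 'M[R]_3 :=
  let s := enter (hinge O) x in placed_rot O (panel s) *m Rz (heading s).

Definition frame_origin (x : 'I_(nc O) * bool) : 'cV[R]_3 :=
  let s := enter (hinge O) x in placed_rot O (panel s) *m start s + placed_pos O (panel s).

Definition frame (x : 'I_(nc O) * bool) : 'M[R]_(3 + 1) :=
  rigid (frame_rot x) (frame_origin x).

(* The products start and end in the panel lying between the last crease and
   the first one, whence the conjugating frames. *)
Definition global_vertex_rotation (v : 'I_(nv O)) (r : 'rV[R]_(nc O)) : 'M[R]_3 :=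
  let F := frame_rot (vcross O v ord_max) in F *m vertex_rotation v r *m F^T.

Definition global_hole_motion (h : 'I_(nh O)) (r : 'rV[R]_(nc O)) : 'M[R]_(3 + 1) :=
  let G := frame (hcross O h ord_max) in G *m hole_motion h r *m invmx G.

Definition vertex_components (v : 'I_(nv O)) (r : 'rV[R]_(nc O)) : 'rV[R]_3 :=
  skew_part (global_vertex_rotation v r).

Definition hole_components (h : 'I_(nh O)) (r : 'rV[R]_(nc O)) : 'rV[R]_(3 + 3) :=
  let T := global_hole_motion h r in row_mx (skew_part (ulsubmx T)) (ursubmx T)^T.

Definition components (r : 'rV[R]_(nc O)) : 'rV[R]_(nv O * 3 + nh O * (3 + 3)) :=
  row_mx (mxvec (\matrix_v vertex_components v r))
         (mxvec (\matrix_h hole_components h r)).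

(* dA/drho; the library's Jacobian acts on row vectors, hence the transpose *)
Definition rigidity_matrix : 'M[R]_(nv O * 3 + nh O * (3 + 3), nc O) :=
  (jacobian components (rho O))^T.

Definition first_order_rigid : Prop :=
  forall rho' : 'cV[R]_(nc O), rigidity_matrix *m rho' = 0 -> rho' = 0.

Definition can_resolve (l : 'rV[R]_(nc O)) : Prop :=
  exists omega : 'rV[R]_(nv O * 3 + nh O * (3 + 3)), omega *m rigidity_matrix = l.

Definition statically_rigid : Prop := forall l, can_resolve l.

Definition self_stresses : {vspace 'rV[R]_(nv O * 3 + nh O * (3 + 3))} :=
  lker (linfun (mulmxr rigidity_matrix)).

Lemma self_stressesP omega :
  reflect (omega *m rigidity_matrix = 0) (omega \in self_stresses).
Proof. by rewrite memv_ker lfunE; exact: eqP. Qed.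

End Rigidity.

(* Main.v *)
Require Import Defs.
From mathcomp Require Import all_boot all_order all_algebra.
From mathcomp Require Import all_classical all_reals all_analysis.
Local Open Scope ring_scope.

(** The equivalences are linear algebra and hold for every m x n matrix [M] over
    a field, in particular for the rigidity matrix.  First-order rigidity says
    that the columns of [M] are linearly independent, static rigidity that its
    rows span all row vectors; both mean that [M] has rank n, because row rank
    and column rank agree ([mulmx_inj_row_full] and [mulmx_surj_row_full]).
    Self-stresses form the kernel of the map [omega |-> omega *m M], whose image
    is the space of loads that can be resolved.  By the rank-nullity theorem, the
    image is the whole n-dimensional space exactly when the kernel has dimension
    m - n ([mulmx_surj_dim_ker]). *)

Import GRing.Theory.

(** The column vectors killed by [M] are the transposes of the row vectors
    killed by [M^T], so this is the criterion of row-freeness for [M^T], whose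
    rank is that of [M]. *)
Lemma mulmx_inj_row_full (F : fieldType) (m n : nat) (M : 'M[F]_(m, n)) :
  (forall x : 'cV[F]_n, M *m x = 0 -> x = 0) <-> row_full M.
Proof.
have -> : row_full M = row_free M^T by rewrite /row_full /row_free mxrank_tr.
split=> [M_inj | freeM x Mx0].
  apply/inj_row_free => v vM0; apply: trmx_inj; rewrite trmx0; apply: M_inj.
  by apply: trmx_inj; rewrite trmx_mul trmxK vM0 trmx0.
apply: trmx_inj; rewrite trmx0; apply: (row_free_inj freeM).
by rewrite mul0mx -trmx_mul Mx0 trmx0.
Qed.

Lemma mulmx_surj_row_full (F : fieldType) (m n : nat) (M : 'M[F]_(m, n)) :
  (forall l : 'rV[F]_n, exists w : 'rV[F]_m, w *m M = l) <-> row_full M.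
Proof.
split=> [M_surj | fullM l].
  rewrite -sub1mx; apply/row_subP => i.
  by have [w <-] := M_surj (row i 1%:M); apply: submxMl.
by have /submxP [w ->] := submx_full l fullM; exists w.
Qed.

(** Rank-nullity for [w |-> w *m M].  The difference is taken in the integers:
    for m < n the right-hand side is negative, and the map is not onto. *)
Lemma mulmx_surj_dim_ker (F : fieldType) (m n : nat) (M : 'M[F]_(m, n)) :
  (forall l : 'rV[F]_n, exists w : 'rV[F]_m, w *m M = l) <->
  (\dim (lker (linfun (mulmxr M : 'rV[F]_m -> 'rV[F]_n))))%:Z = m%:Z - n%:Z.
Proof.
set f := linfun _.
have rank_nullity : (\dim (lker f) + \dim (limg f) = m)%N.
  by rewrite -[lker f]capfv limg_ker_dim dimvf /dim /= mul1n.
have dim_load : \dim {: 'rV[F]_n} = n by rewrite dimvf /dim /= mul1n.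
have -> : (\dim (lker f))%:Z = m%:Z - n%:Z <-> \dim (limg f) = n.
  move: (\dim (lker f)) (\dim (limg f)) rank_nullity => k r <-.
  rewrite PoszD -addrA; split=> [/eqP | ->]; last by rewrite subrr addr0.
  by rewrite -{1}[k%:Z]addr0 (inj_eq (addrI _)) eq_sym subr_eq0 => /eqP [].
split=> [M_surj | dim_img l].
  rewrite -[RHS]dim_load; congr (\dim _); apply/eqP; rewrite eqEsubv subvf /=.
  apply/subvP => l _; have [w <-] := M_surj l.
  by rewrite -[w *m M](lfunE (mulmxr M)) memv_img ?memvf.
have img_full : limg f = fullv.
  by apply/eqP; rewrite eqEdim subvf dim_load dim_img leqnn.
have /memv_imgP [w _ ->] : l \in limg f by rewrite img_full memvf.
by exists w; rewrite lfunE.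
Qed.

Theorem theorem1 (R : realType) (O : rigid_origami R) :
  (first_order_rigid O <-> statically_rigid O) /\
  (statically_rigid O <->
   (\dim (self_stresses O))%:Z = (3 * nv O + 6 * nh O)%:Z - (nc O)%:Z).
Proof.
split.
  exact: iff_trans (mulmx_inj_row_full _ _ _ _)
                   (iff_sym (mulmx_surj_row_full _ _ _ _)).
rewrite (mulnC 3) (mulnC 6); exact: mulmx_surj_dim_ker.
Qed.
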